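(* Suppose $f$ is $L_f$-smooth and $L_{\mathbf S}^{\max}<\infty$. Let $T\ge1$ and $0<\gamma\le 1/\big(L_f\sqrt{L_{\mathcal D}L_{\mathbf S}^{\max}T}\big)$, and let $(x^t)$ be generated by Double Sketched GD. Then $$\min_{0\le t<T}\mathbb E\|\nabla\tilde f(x^t)\|^2\le\frac{3(\tilde f(x^0)-\tilde f^{\inf})}{\gamma T}+\gamma L_f^2L_{\mathcal D}L_{\mathbf S}^{\max}\big(\tilde f^{\inf}-f^{\inf}\big).$$
   Context: Let $f:\mathbb R^d\to\mathbb R$, fix $s\in\mathbb R^d$, and let $\mathcal D$ be a distribution of random matrices $\mathbf S\in\mathbb R^{d\times d}$ with $\mathbb E[\mathbf S]=I$ and $\mathbb E[\mathbf S^\top\mathbf S]$ finite. Define $f_{\mathbf S}(x)=f(s+\mathbf S(x-s))$, $\tilde f(x)=\mathbb E_{\mathbf S\sim\mathcal D}[f_{\mathbf S}(x)]$, $\tilde f^{\inf}=\inf_x\tilde f(x)$, $L_{\mathcal D}=\lambda_{\max}(\mathbb E[\mathbf S^\top\mathbf S])$, and $L_{\mathbf S}^{\max}$ the smallest constant with $\lambda_{\max}(\mathbf S^\top\mathbf S)\le L_{\mathbf S}^{\max}$ a.s. Double Sketched GD: given $x^0$, for $t\ge0$ draw $\mathbf S^t\sim\mathcal D$ independently of the past and set $x^{t+1}=x^t-\gamma(\mathbf S^t)^\top\nabla f(s+\mathbf S^t(x^t-s))$. $f$ is $L_f$-smooth if differentiable, $f(x+h)\le f(x)+\langle\nabla f(x),h\rangle+\frac{L_f}{2}\|h\|^2$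 for all $x,h$, and bounded below by $f^{\inf}\in\mathbb R$. *)

(* Defs.v *)
From HB Require Import structures.
From mathcomp Require Import all_boot all_order all_algebra.
From mathcomp Require Import all_classical all_reals all_analysis.
Set Implicit Arguments. Unset Strict Implicit. Unset Printing Implicit Defensive.
Import Order.TTheory GRing.Theory Num.Theory.
Import numFieldNormedType.Exports.
Local Open Scope classical_set_scope.
Local Open Scope ring_scope.

Section Defs.
Context {R : realType} {dim : nat}.
Local Notation V := 'cV[R]_dim.

Definition dotv (u v : V) : R := \sum_(i < dim) u i ord0 * v i ord0.
Definition sqnorm (v : V) : R := dotv v v.

Definition grad (F : V -> R) (x : V) : V := \col_i ('d F x (delta_mx i ord0 : V)).

Definition Lsmooth (L : R) (f : V -> R) : Prop :=
  (forall x : V, differentiable f x) /\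
  forall x h : V, f (x + h) <= f x + dotv (grad f x) h + L / 2 * sqnorm h.

Definition lambda_max (M : 'M[R]_dim) : R := sup [set a | eigenvalue M a].

Context {d0 : measure_display} {Omega : measurableType d0}.

Definition Emx m n (P : probability Omega R) (M : Omega -> 'M[R]_(m, n)) : 'M[R]_(m, n) :=
  \matrix_(i, j) Rintegral P setT (fun w => M w i j).

Definition fS (f : V -> R) (s : V) (S : 'M[R]_dim) (x : V) : R := f (s + S *m (x - s)).
Definition ftilde (P : probability Omega R) (S : Omega -> 'M[R]_dim)
  (f : V -> R) (s : V) (x : V) : R :=
  Rintegral P setT (fun w => fS f s (S w) x).

(* Double Sketched GD: the iterate after the draws l = [:: w_0; ...; w_{t-1}] *)
Definition dsgd_step (gamma : R) (f : V -> R) (s : V) (S : 'M[R]_dim) (x : V) : V :=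
  x - gamma *: ((S^T) *m grad f (s + S *m (x - s))).
Definition dsgd (gamma : R) (f : V -> R) (s : V) (S : Omega -> 'M[R]_dim)
  (x0 : V) (l : seq Omega) : V :=
  foldl (fun x w => dsgd_step gamma f s (S w) x) x0 l.

(* Expectation over n independent draws w_0, ..., w_{n-1} ~ P (iterated integral) *)
Fixpoint Eseq (P : probability Omega R) (n : nat) (F : seq Omega -> \bar R) : \bar R :=
  match n with
  | 0 => F [::]
  | n'.+1 => (\int[P]_w Eseq P n' (fun l => F (w :: l)))%E
  end.

End Defs.

(* Main.v *)
Require Import Defs.
From HB Require Import structures.
From mathcomp Require Import all_boot all_order all_algebra.
From mathcomp Require Import all_classical all_reals all_analysis.
From mathcomp Require Import measurable_realfun ring lra.
Import Order.TTheory GRing.Theory Num.Theory.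
Import numFieldNormedType.Exports.
Local Open Scope classical_set_scope.
Local Open Scope ring_scope.
Set Implicit Arguments. Unset Strict Implicit. Unset Printing Implicit Defensive.

(* Write ft for the sketched objective, G(x) = grad ft(x) = E[S^T grad f(s + S(x - s))],
   delta(x) = ft(x) - inf ft and a = gamma^2 Lf^2 LD LSmax <= 1/T.  The function
   ft is (Lf LD)-smooth, |S^T v|^2 <= LSmax |v|^2 almost surely, and
   |grad f|^2 <= 2 Lf (f - inf f); hence one step satisfies
     gamma |G(x)|^2 + E delta(x') <= (1 + a) delta(x) + a (inf ft - inf f).
   Weighting step t by (1 + a)^-(t+1) telescopes, and (1 + a)^T <= 3 bounds the
   total weight below by T/3.  Smoothness being one-sided, grad f need not be
   Lipschitz; ft is differentiable by dominated convergence, the lower bound on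
   the Taylor remainder coming from semiconcavity. *)

(** * Euclidean inner product, quadratic forms and the top eigenvalue *)

Section InnerProduct.
Context {R : realType} {n : nat}.
Implicit Types (u v w x y : 'cV[R]_n) (a c : R) (M A : 'M[R]_n).

Lemma dotvC u v : dotv u v = dotv v u.
Proof. by apply: eq_bigr => i _; rewrite mulrC. Qed.

Lemma dotvDl u v w : dotv (u + v) w = dotv u w + dotv v w.
Proof. by rewrite -big_split; apply: eq_bigr => i _; rewrite mxE mulrDl. Qed.

Lemma dotvZl a u v : dotv (a *: u) v = a * dotv u v.
Proof. by rewrite mulr_sumr; apply: eq_bigr => i _; rewrite mxE mulrA. Qed.

Lemma dotvNl u v : dotv (- u) v = - dotv u v.
Proof. by rewrite -scaleN1r dotvZl mulN1r. Qed.

Lemma dotvDr u v w : dotv u (v + w) = dotv u v + dotv u w.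
Proof. by rewrite dotvC dotvDl !(dotvC _ u). Qed.

Lemma dotvZr a u v : dotv u (a *: v) = a * dotv u v.
Proof. by rewrite dotvC dotvZl dotvC. Qed.

Lemma dotvNr u v : dotv u (- v) = - dotv u v.
Proof. by rewrite dotvC dotvNl dotvC. Qed.

Lemma sqnorm_ge0 v : 0 <= sqnorm v.
Proof. by apply: sumr_ge0 => i _; rewrite -expr2 sqr_ge0. Qed.

Lemma sqnormZ a v : sqnorm (a *: v) = a ^+ 2 * sqnorm v.
Proof. by rewrite /sqnorm dotvZl dotvZr mulrA expr2. Qed.

Lemma sqnorm_gt0 v : (0 < sqnorm v) = (v != 0).
Proof.
rewrite lt0r sqnorm_ge0 andbT; congr negb; apply/eqP/eqP => [v0|->]; last first.
  by apply: big1 => i _; rewrite mxE mul0r.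
apply/matrixP => i j; rewrite ord1 mxE.
have /eqP : v i ord0 ^+ 2 = 0 := psumr_eq0P (fun k _ => sqr_ge0 (v k ord0)) v0 isT.
by rewrite sqrf_eq0 => /eqP.
Qed.

Lemma dotv_mulmx M u v : dotv u (M *m v) = dotv (M^T *m u) v.
Proof.
rewrite /dotv (eq_bigr (fun i => \sum_j u i ord0 * (M i j * v j ord0))); last first.
  by move=> i _; rewrite mxE mulr_sumr.
rewrite exchange_big /=; apply: eq_bigr => j _; rewrite mxE mulr_suml.
by apply: eq_bigr => i _; rewrite mxE mulrA (mulrC (M i j)).
Qed.

Lemma sqnorm_mulmx M v : sqnorm (M *m v) = dotv v (M^T *m M *m v).
Proof. by rewrite /sqnorm dotvC dotv_mulmx mulmxA dotvC. Qed.

Lemma coord_le_sqnorm v i : v i ord0 ^+ 2 <= sqnorm v.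
Proof.
rewrite /sqnorm /dotv (bigD1 i) //= -expr2 lerDl.
by apply: sumr_ge0 => j _; rewrite -expr2 sqr_ge0.
Qed.

Lemma dotv_bounded M : exists2 C, 0 < C & forall v, dotv v (M *m v) <= C * sqnorm v.
Proof.
exists (1 + \sum_i \sum_j `|M i j|) => [|v].
  by rewrite ltr_wpDr// sumr_ge0// => i _; apply: sumr_ge0.
rewrite mulrDl mul1r ler_wpDl ?sqnorm_ge0// mulr_suml; apply: ler_sum => i _.
rewrite mxE mulr_sumr mulr_suml; apply: ler_sum => j _.
rewrite mulrCA (le_trans (ler_norm _))// normrM ler_wpM2l//.
have := coord_le_sqnorm v i; have := coord_le_sqnorm v j.
have := sqr_ge0 (v i ord0 - v j ord0); have := sqr_ge0 (v i ord0 + v j ord0).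
by rewrite ler_norml => *; apply/andP; split; nra.
Qed.

(** Semidefinite forms are allowed so that it covers both the identity and a shifted matrix
    [mu%:M - M]. *)
Lemma psd_CauchySchwarz M u v : M^T = M -> (forall w, 0 <= dotv w (M *m w)) ->
  dotv u (M *m v) ^+ 2 <= dotv u (M *m u) * dotv v (M *m v).
Proof.
move=> Msym Mpsd.
have Mvu : dotv v (M *m u) = dotv u (M *m v) by rewrite dotvC [RHS]dotv_mulmx Msym.
have q s t : 0 <= s ^+ 2 * dotv u (M *m u) + 2 * s * t * dotv u (M *m v)
                  + t ^+ 2 * dotv v (M *m v).
  have := Mpsd (s *: u + t *: v).
  rewrite mulmxDr -!scalemxAr !(dotvDl, dotvDr, dotvZl, dotvZr) Mvu.
  by congr (_ <= _); ring.
have := Mpsd u; have := Mpsd v; move: q.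
move: (dotv u _) (dotv v _) (dotv u _) => b c a q c0 a0.
(* The first two choices give [c * (a * c - b ^+ 2) >= 0] and [a * (a * c - b ^+ 2) >= 0]; the last
   two force [b = 0] when [a = c = 0]. *)
have := q c (- b); have := q b (- a); have := q (-1) b; have := q 1 (- b).
have [/eqP c_eq0|c_neq0] := boolP (c == 0); last first.
  have : 0 < c by rewrite lt0r c_neq0.
  by move=> {}c0 _ _ _ h; rewrite -(ler_pM2l c0); nra.
have [/eqP a_eq0|a_neq0] := boolP (a == 0); last first.
  have : 0 < a by rewrite lt0r a_neq0.
  by move=> {}a0 _ _ h _; rewrite -(ler_pM2l a0); nra.
by rewrite a_eq0 c_eq0; nra.
Qed.

(* With mu the supremum of the Rayleigh quotient, mu - M is positive
   semidefinite; were it invertible, Cauchy-Schwarz would make it definite and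
   mu could be lowered. *)
Lemma dotv_le_lambda_max M v : M^T = M ->
  dotv v (M *m v) <= lambda_max M * sqnorm v.
Proof.
move=> Msym; have [C C_gt0 leC] := dotv_bounded M.
have [->|v0] := eqVneq v 0.
  by rewrite /sqnorm mulmx0 /dotv !big1 ?mulr0// => i _; rewrite !mxE mul0r.
pose Q := [set dotv u (M *m u) / sqnorm u | u in [set u | u != 0]].
have Qub : has_ubound Q.
  by exists C => _ [u /= u0 <-]; rewrite ler_pdivrMr ?sqnorm_gt0.
pose mu := sup Q; pose B := mu%:M - M.
have leQ u : dotv u (M *m u) <= mu * sqnorm u.
  have [->|u0] := eqVneq u 0.
    by rewrite /sqnorm mulmx0 /dotv !big1 ?mulr0// => i _; rewrite !mxE mul0r.
  by rewrite -ler_pdivrMr ?sqnorm_gt0//; apply: ub_le_sup => //; exists u.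
have BE u : dotv u (B *m u) = mu * sqnorm u - dotv u (M *m u).
  by rewrite mulmxBl mul_scalar_mx dotvDr dotvNr dotvZr.
have Bpsd u : 0 <= dotv u (B *m u) by rewrite BE subr_ge0.
have Bsym : B^T = B by rewrite /B linearB /= tr_scalar_mx Msym.
have mu_eig : eigenvalue M mu.
  rewrite -[eigenvalue _ _]negbK; apply/negP; rewrite /eigenvalue negbK => /eqP ker0.
  have Bunit : B \in unitmx.
    rewrite -row_free_unit; apply: inj_row_free => u uB; apply/eqP.
    rewrite -submx0 -ker0; apply/eigenspaceP; apply/eqP.
    by rewrite eq_sym -subr_eq0 -mul_mx_scalar -mulmxBr uB.
  have [D D_gt0 leD] := dotv_bounded (invmx B).
  have lower u : sqnorm u / D <= dotv u (B *m u).
    have [->|u0] := eqVneq u 0.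
      by rewrite /sqnorm mulmx0 /dotv !big1 ?mul0r// => i _; rewrite !mxE mul0r.
    have := psd_CauchySchwarz u (invmx B *m u) Bsym Bpsd.
    rewrite mulKVmx// -/(sqnorm u) [X in _ * X]dotvC => CS.
    have s_gt0 : 0 < sqnorm u by rewrite sqnorm_gt0.
    rewrite ler_pdivrMr// -(ler_pM2r s_gt0) -expr2 (le_trans CS)//.
    by rewrite -mulrA ler_wpM2l.
  have : mu <= mu - D^-1.
    apply: ge_sup; first by exists (dotv v (M *m v) / sqnorm v), v.
    move=> _ [u /= u0 <-]; rewrite ler_pdivrMr ?sqnorm_gt0//.
    by have := lower u; rewrite BE mulrBl; lra.
  by rewrite lerDl oppr_ge0 leNgt invr_gt0 D_gt0.
apply: (le_trans (leQ v)); rewrite ler_wpM2r ?sqnorm_ge0//.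
(* The eigenvalues must be bounded above for [sup] to dominate them. Eigenvectors are row vectors,
   hence the transpose and the use of symmetry. *)
apply: ub_le_sup => //; exists C => a /eigenvalueP[u uM u0].
have uT0 : u^T != 0 by rewrite trmx_eq0.
rewrite -(ler_pM2r (_ : 0 < sqnorm u^T)) ?sqnorm_gt0// -dotvZr.
by rewrite (le_trans _ (leC u^T))// -[X in X *m u^T]Msym -trmx_mul uM linearZ.
Qed.

(** With [u = A^T *m v], Cauchy-Schwarz on [sqnorm u = dotv v (A *m u)] gives [sqnorm u ^+ 2 <=
    sqnorm v * (c * sqnorm u)], and one factor [sqnorm u] cancels. *)
Lemma sqnorm_trmx_mul_le A c v : lambda_max (A^T *m A) <= c ->
  sqnorm (A^T *m v) <= c * sqnorm v.
Proof.
move=> lec; pose u := A^T *m v.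
have ule : sqnorm (A *m u) <= c * sqnorm u.
  rewrite sqnorm_mulmx (le_trans (dotv_le_lambda_max _ _)) ?ler_wpM2r ?sqnorm_ge0//.
  by rewrite trmx_mul trmxK.
have uE : sqnorm u = dotv v (A *m u) by rewrite dotv_mulmx.
have := psd_CauchySchwarz v (A *m u) (tr_scalar_mx _ 1).
have idpsd (w : 'cV[R]_n) : 0 <= dotv w (1%:M *m w) by rewrite mul1mx sqnorm_ge0.
move=> /(_ idpsd); rewrite !mul1mx -uE -!/(sqnorm _) => CS.
(* This settles the case [u = 0], where nothing can be cancelled. *)
have cv_ge0 : 0 <= c * sqnorm v.
  rewrite (le_trans (sqnorm_ge0 (A *m v)))// sqnorm_mulmx.
  rewrite (le_trans (dotv_le_lambda_max _ _)) ?ler_wpM2r ?sqnorm_ge0//.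
  by rewrite trmx_mul trmxK.
have [u0|u0] := eqVneq u 0.
  by rewrite -/u u0 -(scale0r u) sqnormZ expr0n mul0r.
have su : 0 < sqnorm u by rewrite sqnorm_gt0.
rewrite -(ler_pM2r su) -expr2 (le_trans CS)// mulrAC mulrC.
by rewrite ler_wpM2r ?sqnorm_ge0.
Qed.

End InnerProduct.

(** The all-ones vector is a nonzero test vector in positive dimension. In dimension zero there are
    no eigenvalues and [sup] of the empty set is 0. *)
Lemma psd_lambda_max_ge0 (R : realType) n (M : 'M[R]_n) : M^T = M ->
  (forall v, 0 <= dotv v (M *m v)) -> 0 <= lambda_max M.
Proof.
case: n M => [|n] M Msym Mpsd.
  rewrite /lambda_max (_ : [set a | _] = set0) ?sup0//; apply/seteqP; split => // a /=.
  by move=> /eigenvalueP[v _]; rewrite thinmx0 eqxx.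
have v0 : 0 < sqnorm (const_mx 1 : 'cV[R]_n.+1).
  rewrite sqnorm_gt0; apply/eqP => /matrixP/(_ ord0 ord0)/eqP.
  by rewrite !mxE oner_eq0.
rewrite -(pmulr_lge0 _ v0).
exact: le_trans (Mpsd (const_mx 1)) (dotv_le_lambda_max _ Msym).
Qed.

(** * Gradients, one-sided smoothness and differentiability *)

Section Gradient.
Context {R : realType} {n : nat}.
Implicit Types (F f : 'cV[R]_n -> R) (x y h v G : 'cV[R]_n).

Lemma dotv_grad F x h : dotv (grad F x) h = 'd F x h.
Proof.
have {2}-> : h = \sum_(i < n) h i ord0 *: (delta_mx i ord0 : 'cV[R]_n).
  by rewrite [LHS]matrix_sum_delta; apply: eq_bigr => i _; rewrite big_ord1.
by rewrite linear_sum; apply: eq_bigr => i _; rewrite linearZ /= mxE mulrC.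
Qed.

Lemma diff_quotient_cvg F x v : differentiable F x ->
  k.+1%:R * (F (x + k.+1%:R^-1 *: v) - F x) @[k --> \oo] --> ('d F x v : R).
Proof.
move=> Fx; rewrite -deriveE//.
have h0' : @harmonic R k @[k --> \oo] --> 0^'.
  move=> A A0; have [N _ hN] := @cvg_harmonic R _ A0; exists N => // k /hN.
  apply.
  have k0 : (k.+1%:R^-1 : R) != 0 by rewrite invr_eq0 pnatr_eq0.
  exact: k0.
have := @cvg_comp _ _ _ _ _ _ _ _ h0' (@diff_derivable _ _ _ F x v Fx).
apply: cvg_trans; apply: near_eq_cvg; apply: nearW => k.
by rewrite /= invrK /shift /= [in LHS](addrC _ x).
Qed.

(** Along small multiples of [v] the quadratic term vanishes in the difference quotient, leaving
    ['d F x v <= dotv G v]; the same at [- v] gives equality by linearity. *)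
Lemma grad_of_quadratic_upper_bound F x G C : differentiable F x ->
  (forall h, F (x + h) <= F x + dotv G h + C * sqnorm h) -> grad F x = G.
Proof.
move=> Fx ub; have le v : 'd F x v <= dotv G v.
  have rhs : dotv G v + (C * sqnorm v) * @harmonic R k @[k --> \oo] --> dotv G v.
    rewrite -[X in _ --> X]addr0 -[X in _ --> _ + X](mulr0 (C * sqnorm v)).
    by apply: cvgD; [exact: cvg_cst|apply: cvgM; [exact: cvg_cst|exact: cvg_harmonic]].
  apply: ler_cvg_to (diff_quotient_cvg (v := v) Fx) rhs _.
  near=> k; rewrite -ler_pdivlMl//.
  have := ub (k.+1%:R^-1 *: v); rewrite dotvZr sqnormZ /=.
  have : 0 < (k.+1%:R : R) by [].
  move: (k.+1%:R : R) => c c0; rewrite -addrA -lerBlDl => /le_trans; apply.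
  by rewrite le_eqVlt; apply/orP; left; apply/eqP; field; exact: lt0r_neq0.
apply/colP => i; rewrite mxE; apply/le_anti/andP; split.
  rewrite (le_trans (le _))// /dotv (bigD1 i)//= big1 ?addr0 => [|j ji].
    by rewrite mxE !eqxx mulr1.
  by rewrite mxE (negbTE ji) mulr0.
have := le (- delta_mx i ord0); rewrite linearN dotvNr lerN2; apply: le_trans.
rewrite /dotv (bigD1 i)//= big1 ?addr0 => [|j ji].
  by rewrite mxE !eqxx mulr1.
by rewrite mxE (negbTE ji) mulr0.
Unshelve. all: by end_near. Qed.

(** A gradient step of size [L^-1] lowers [f] by at least [sqnorm (grad f x) / (2 * L)], and the
    value reached is still at least [m]. *)
Lemma Lsmooth_sqnorm_grad L f m x : 0 < L -> Lsmooth L f ->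
  (forall y, m <= f y) -> sqnorm (grad f x) <= 2 * L * (f x - m).
Proof.
move=> L0 [_ ub] lb; have := le_trans (lb _) (ub x (- L^-1 *: grad f x)).
rewrite dotvZr sqnormZ -/(sqnorm _) => le; rewrite -(ler_pM2l (_ : 0 < (2 * L)^-1)).
  rewrite mulKf ?mulf_neq0 ?pnatr_eq0 ?lt0r_neq0//.
  rewrite lerBrDr -lerBrDl (le_trans le)// le_eqVlt; apply/orP; left; apply/eqP.
  by field; exact: lt0r_neq0.
by rewrite invr_gt0 mulr_gt0.
Qed.

(** Expand at [x + t *: h] towards the endpoints [x] and [x + h], with weights [1 - t] and [t]: the
    gradient terms cancel. *)
Lemma Lsmooth_semiconcave L f x h t : Lsmooth L f -> 0 <= t <= 1 ->
  (1 - t) * f x + t * f (x + h) - L / 2 * (t * (1 - t)) * sqnorm h <= f (x + t *: h).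
Proof.
move=> [_ ub] /andP[t0 t1]; have := ub (x + t *: h) (- t *: h).
have := ub (x + t *: h) ((1 - t) *: h).
rewrite -[x + _ + _]addrA -[x + _ + _ *: _]addrA -!scalerDl.
rewrite [t + (1 - t)]addrC subrK scale1r addrN scale0r addr0.
rewrite !dotvZr !sqnormZ; nra.
Qed.

Lemma dotv_is_linear (u : 'cV[R]_n) : linear_for *:%R (dotv u : 'cV[R]_n -> R^o).
Proof. by move=> a v w; rewrite dotvDr dotvZr. Qed.

HB.instance Definition _ (u : 'cV[R]_n) :=
  GRing.isLinear.Build R 'cV[R]_n R^o *:%R (dotv u) (dotv_is_linear u).

Lemma dotv_continuous (u : 'cV[R]_n) : continuous (dotv u).
Proof.
apply: continuous_big => [|i _ x]; first exact: add_continuous.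
apply: (@continuous_comp _ _ _ (fun v : 'cV[R]_n => v i ord0) ( *%R (u i ord0))).
  exact: coord_continuous.
exact: mulrl_continuous.
Qed.

(** The differential ['d F x] is obtained by choice, so uniqueness first identifies it with
    [dotv G]. *)
Lemma differentiable_of_remainder F x G : (forall eps, 0 < eps ->
  \forall h \near nbhs (0 : 'cV[R]_n), `|F (x + h) - F x - dotv G h| <= eps * `|h|) ->
  differentiable F x.
Proof.
move=> o.
have D : 'd F x = dotv G :> ('cV[R]_n -> R).
  apply: (@diff_unique R 'cV[R]_n R F (dotv G) x); first exact: dotv_continuous.
  apply/eqaddoP => eps e0; apply: filterS (o _ e0) => h.
  by rewrite /= !fctE opprD addrA /= [h + x]addrC.
apply/diff_locallyP; rewrite D; split; first exact: dotv_continuous.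
apply/eqaddoP => eps e0; apply: filterS (o _ e0) => h.
by rewrite /= !fctE opprD addrA /= [h + x]addrC.
Qed.

Lemma coord_le_norm v i : `|v i ord0| <= `|v|.
Proof.
rewrite [leRHS]/Num.norm /= mx_normrE.
exact: (le_bigmax _ (fun ij => `|v ij.1 ij.2|) (i, ord0)).
Qed.

Lemma norm_le_coord v (c : R) : 0 <= c -> (forall i, `|v i ord0| <= c) -> `|v| <= c.
Proof.
move=> c0 vc; rewrite [leLHS]/Num.norm /= mx_normrE.
by apply/bigmax_leP; split => // -[i j] _; rewrite ord1.
Qed.

Lemma sqnorm_le_norm v : sqnorm v <= n%:R * `|v| ^+ 2.
Proof.
rewrite -[n in n%:R]card_ord -sumr_const mulr_suml; apply: ler_sum => i _.
rewrite mul1r -expr2 -real_normK ?num_real// lerXn2r ?nnegrE//.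
exact: coord_le_norm.
Qed.

Lemma norm_mulmx_bounded (A : 'M[R]_n) :
  exists2 C, 0 < C & forall v : 'cV[R]_n, `|A *m v| <= C * `|v|.
Proof.
have S0 : 0 <= \sum_i \sum_j `|A i j| by apply: sumr_ge0 => i _; exact: sumr_ge0.
exists (1 + \sum_i \sum_j `|A i j|) => [|v]; first by rewrite ltr_wpDr.
apply: norm_le_coord => [|i]; first by rewrite mulr_ge0 ?addr_ge0.
rewrite mxE (le_trans (ler_norm_sum _ _ _))// mulrDl mul1r ler_wpDl//.
rewrite [X in _ <= X * _](bigD1 i)//= mulrDl ler_wpDr//.
  by rewrite mulr_ge0// sumr_ge0// => k _; exact: sumr_ge0.
rewrite mulr_suml; apply: ler_sum => j _; rewrite normrM ler_wpM2l//.
exact: coord_le_norm.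
Qed.

Lemma differentiable_mulmx_remainder f y (A : 'M[R]_n) eps :
  differentiable f y -> 0 < eps ->
  \forall h \near nbhs (0 : 'cV[R]_n),
    `|f (y + A *m h) - f y - 'd f y (A *m h)| <= eps * `|h|.
Proof.
move=> fy e0; have [C C0 AC] := norm_mulmx_bounded A.
have eC0 : 0 < eps / C by rewrite divr_gt0.
have [_ /eqaddoP/(_ _ eC0)/nbhs_ballP[r /= r0 rP]] := (diff_locallyP y f).1 fy.
apply/nbhs_ballP; exists (r / C) => /=; first by rewrite divr_gt0.
move=> h; rewrite -ball_normE /= sub0r normrN ltr_pdivlMr// => hr.
have := rP (A *m h); rewrite -ball_normE /= sub0r normrN => /(_ _)/le_trans.
rewrite !fctE /= opprD addrA [_ + y]addrC; apply.
  by rewrite (le_lt_trans (AC h))// mulrC.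
by rewrite -mulrA ler_wpM2l ?(ltW e0)// ler_pdivrMl.
Qed.

End Gradient.

(** * Measurability of a function and of its gradient along a random vector *)

Section Measurability.
Context {R : realType} {n : nat} {d : measure_display} {T : measurableType d}.
Implicit Types (f : 'cV[R]_n -> R) (Y : T -> 'cV[R]_n).

(** An open set of vectors is a countable union of boxes with rational centres and radii
    [k.+1%:R^-1]; each box pulls back to a finite intersection of measurable sets. *)
Lemma measurable_continuous_comp f Y : continuous f ->
  (forall i, measurable_fun setT (fun w => Y w i ord0)) ->
  measurable_fun setT (fun w => f (Y w)).
Proof.
move=> fc mY; apply: (measurability _ (RGenOpens.measurableE R)).
move=> _ [_ [a [b ->] <-]]; rewrite setTI.
set U := f @^-1` `]a, b[%classic.
have Uo : open U by apply: open_comp => // x _; exact: fc.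
pose box (p : {ffun 'I_n -> rat} * nat) : set 'cV[R]_n :=
  [set y | forall i, ball (ratr (p.1 i) : R) p.2.+1%:R^-1 (y i ord0)].
pose good p := box p `<=` U.
rewrite (_ : _ @^-1` _ = \bigcup_p (if `[< good p >] then Y @^-1` box p else set0)).
  apply: countable_bigcupT_measurable => [|p]; first exact: countableP.
  case: ifP => // _.
  rewrite (_ : _ @^-1` _ = \bigcap_(i in setT)
      (fun w => Y w i ord0) @^-1` ball (ratr (p.1 i) : R) p.2.+1%:R^-1).
    apply: fin_bigcap_measurable => // i _; rewrite -[X in measurable X]setTI.
    by apply: mY => //; exact: measurable_ball.
  by apply/seteqP; split => w /= Yw i; have := Yw i; [|apply].
apply/seteqP; split => [w Uw|w [p _]]; last first.
  by case: ifP => // /asboolP pU /pU.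
have /nbhs_ballP[e /= e0 eU] : nbhs (Y w) U by exact: open_nbhs_nbhs.
(* One half of [e] goes to the distance from [Y w] to the rational centre, the other to that from
   the centre to a point of the box. *)
have [k ke] : exists k : nat, k.+1%:R^-1 < e / 2.
  have e20 : 0 < e / 2 by rewrite divr_gt0.
  have [k _ /(_ k (leqnn k))] := @cvg_harmonic R _ (nbhsx_ballx 0 _ e20).
  rewrite /= -ball_normE/= sub0r normrN gtr0_norm// => ke.
  by exists k.
have /choice[q qP] i : exists q : rat, `|ratr q - Y w i ord0| < k.+1%:R^-1.
  have [|q] := @rat_in_itvoo R (Y w i ord0 - k.+1%:R^-1) (Y w i ord0 + k.+1%:R^-1).
    by rewrite ltrD2l gtrN.
  by rewrite in_itv/= => /andP[q1 q2]; exists q; rewrite ltr_distl q1 q2.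
exists ([ffun i => q i], k) => //; case: ifPn => [_ i|].
  by rewrite ffunE -ball_normE; exact: qP.
case/asboolP => y by_; apply: eU; split => // i j; rewrite ord1.
rewrite -ball_normE /= -(subrKA (ratr (q i))) (le_lt_trans (ler_normD _ _))//.
have := by_ i; rewrite /= ffunE -ball_normE /= => yq; have := qP i.
by rewrite distrC => qY; rewrite (splitr e) ltrD// (lt_trans _ ke).
Qed.

Lemma measurable_grad_comp f Y i : (forall x, differentiable f x) ->
  (forall i, measurable_fun setT (fun w => Y w i ord0)) ->
  measurable_fun setT (fun w => grad f (Y w) i ord0).
Proof.
move=> fd mY; have fc : continuous f by move=> x; exact: differentiable_continuous.
apply: (@measurable_fun_cvg _ _ _ _ (fun k w => k.+1%:R *
    (f (Y w + k.+1%:R^-1 *: (delta_mx i ord0 : 'cV[R]_n)) - f (Y w)))).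
  move=> k; apply: measurable_funM => //; apply: measurable_funB.
    apply: measurable_continuous_comp => // j.
    by under eq_fun do rewrite mxE; apply: measurable_funD.
  exact: measurable_continuous_comp.
by move=> w _; rewrite mxE; exact: diff_quotient_cvg.
Qed.

End Measurability.

(** * Lower integrals of nonnegative functions *)

Import HBNNSimple.

(* Without measurability the integral of a nonnegative function is a lower
   integral, which is monotone and superadditive; this suffices for the iterated
   integrals of Eseq, whose integrands are not known to be measurable. *)
Section LowerIntegral.
Context {R : realType} {d : measure_display} {T : measurableType d}.
Variable mu : {measure set T -> \bar R}.
Implicit Types (f g : T -> \bar R).
Local Open Scope ereal_scope.

Lemma lower_le_integral f g : (forall x, 0 <= f x) -> (forall x, f x <= g x) ->
  \int[mu]_x f x <= \int[mu]_x g x.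
Proof.
move=> f0 fg; have g0 x : 0 <= g x by rewrite (le_trans (f0 x)).
rewrite !ge0_integralTE//; apply: ge_ereal_sup => _ [h hf <-].
by apply: ereal_sup_ubound; exists h => // x; rewrite (le_trans (hf x)).
Qed.

(** Simple functions below [f] and [g] add up to one below the sum. The suprema are taken one at a
    time; finiteness lets terms cross the inequality. *)
Lemma lower_integral_superadditive f g :
  (forall x, 0 <= f x) -> (forall x, 0 <= g x) ->
  \int[mu]_x f x + \int[mu]_x g x <= \int[mu]_x (f x + g x).
Proof.
move=> f0 g0; have fg0 x : 0 <= f x + g x by exact: adde_ge0.
have [->|Cy] := eqVneq (\int[mu]_x (f x + g x)) +oo; first exact: leey.
have Cfin : \int[mu]_x (f x + g x) \is a fin_num.
  by rewrite ge0_fin_numE ?integral_ge0// ltey.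
have gfin : \int[mu]_x g x \is a fin_num.
  rewrite ge0_fin_numE ?integral_ge0// (@le_lt_trans _ _ (\int[mu]_x (f x + g x))) ?ltey//.
  by apply: lower_le_integral => // x; rewrite leeDr.
rewrite -leeBrDr// [X in X <= _]ge0_integralTE//.
apply: ge_ereal_sup => _ [h1 h1f <-].
have h1fin : sintegral mu h1 \is a fin_num.
  rewrite ge0_fin_numE ?sintegral_ge0// (@le_lt_trans _ _ (\int[mu]_x (f x + g x))) ?ltey//.
  rewrite [leRHS]ge0_integralTE//; apply: ereal_sup_ubound; exists h1 => // x.
  by rewrite (le_trans (h1f x))// leeDl.
rewrite leeBrDr// addeC -leeBrDr// [X in X <= _]ge0_integralTE//.
apply: ge_ereal_sup => _ [h2 h2g <-]; rewrite leeBrDr// addeC -sintegralD.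
rewrite ge0_integralTE//; apply: ereal_sup_ubound; exists (add_nnsfun h1 h2) => // x.
by rewrite /= EFinD leeD// ?h1f ?h2g.
Qed.

Lemma lower_integral_sum (I : Type) (s : seq I) (f : I -> T -> \bar R) :
  (forall i x, 0 <= f i x) ->
  \sum_(i <- s) \int[mu]_x f i x <= \int[mu]_x \sum_(i <- s) f i x.
Proof.
move=> f0; elim: s => [|i s IHs].
  by rewrite big_nil; apply: integral_ge0 => x _; rewrite big_nil.
under eq_integral do rewrite big_cons.
rewrite big_cons (le_trans (leeD2l _ IHs))// lower_integral_superadditive// => x.
exact: sume_ge0.
Qed.

Lemma lower_integralZl (c : R) f : (0 <= c)%R -> (forall x, 0 <= f x) ->
  c%:E * \int[mu]_x f x <= \int[mu]_x (c%:E * f x).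
Proof.
rewrite le_eqVlt => /predU1P[<- f0|c0 f0].
  by rewrite mul0e; apply: integral_ge0 => x _; rewrite mul0e.
rewrite -lee_pdivlMl// [X in X <= _]ge0_integralTE//; apply: ge_ereal_sup => _ [h hf <-].
rewrite lee_pdivlMl// -sintegralrM ge0_integralTE; last first.
  by move=> x; rewrite mule_ge0// lee_fin ltW.
apply: ereal_sup_ubound; exists (scale_nnsfun h (ltW c0)) => // x.
by rewrite /= EFinM lee_pmul2l// ?lte_fin//; exact: hf.
Qed.

End LowerIntegral.

(** * Expectations of constants and of real integrands *)

Section Expectation.
Context {R : realType} {d : measure_display} {Omega : measurableType d}.
Variable P : probability Omega R.
Implicit Types f g : Omega -> R.

Lemma integrable_cstP (c : R) : P.-integrable setT (EFin \o (fun=> c)).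
Proof. exact: finite_measure_integrable_cst. Qed.

Lemma Rintegral_cstP (c : R) : \int[P]_w c = c.
Proof.
rewrite Rintegral_cst//; transitivity (c * fine (1%E : \bar R)); last by rewrite mulr1.
by congr (_ * fine _); exact: probability_setT.
Qed.

Lemma integral_EFinE f : P.-integrable setT (EFin \o f) ->
  (\int[P]_w (f w)%:E)%E = (\int[P]_w f w)%:E.
Proof. by move=> fi; rewrite /Rintegral fineK//; exact: integrable_fin_num. Qed.

End Expectation.

(** * Telescoping a one-step inequality over independent draws *)

Section Descent.
Context {R : realType} {d : measure_display} {Omega : measurableType d}.
Variable P : probability Omega R.

Lemma Eseq_ge0 n (F : seq Omega -> \bar R) : (forall l, 0 <= F l)%E ->
  (0 <= Eseq P n F)%E.
Proof.
by elim: n F => [|n IHn] F F0 //=; apply: integral_ge0 => w _; apply: IHn.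
Qed.

(* The upper bound g is there because delta (step x w) need not be measurable in w. *)
Lemma Eseq_descent (X : Type) (step : X -> Omega -> X) (r delta : X -> R)
    (gamma a D : R) :
  0 <= gamma -> 0 <= a -> 0 <= D ->
  (forall x, 0 <= r x) -> (forall x, 0 <= delta x) ->
  (forall x, exists g : Omega -> R,
     [/\ P.-integrable setT (EFin \o g), forall w, delta (step x w) <= g w &
         gamma * r x + \int[P]_w g w <= (1 + a) * delta x + a * D]) ->
  forall n x,
    (\sum_(t < n) ((1 + a)^-1 ^+ t.+1 * gamma)%:E *
       Eseq P t (fun l => (r (foldl step x l))%:E)
     <= (delta x + a * D * \sum_(t < n) (1 + a)^-1 ^+ t.+1)%:E)%E.
Proof.
move=> gamma0 a0 D0 r0 delta0 onestep; set q := (1 + a)^-1.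
have q0 : 0 <= q by rewrite invr_ge0 addr_ge0.
elim=> [|n IHn] x; first by rewrite !big_ord0 mulr0 addr0 lee_fin.
have [g [ig gub gle]] := onestep x.
pose C := a * D * \sum_(t < n) q ^+ t.+1.
rewrite big_ord_recl /=.
under eq_bigr do rewrite /bump /= add1n.
pose E t w := Eseq P t (fun l => (r (foldl step (step x w) l))%:E).
have E0 t w : (0 <= E t w)%E by apply: Eseq_ge0 => l; rewrite lee_fin.
(* The terms after the first draw: superadditivity brings the sum under the integral, where the
   induction hypothesis at [step x w] applies. *)
have tail : (\sum_(t < n) (q ^+ t.+2 * gamma)%:E * \int[P]_w E t w
             <= (q * (\int[P]_w g w + C))%:E)%E.
  apply: (@le_trans _ _ (q%:E * \int[P]_w \sum_(t < n) (q ^+ t.+1 * gamma)%:E * E t w)%E).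
    rewrite (le_trans _ (lee_wpmul2l _ (lower_integral_sum _ _ _)))//.
    - rewrite ge0_sume_distrr => [|t _]; last first.
        by apply: integral_ge0 => w _; rewrite mule_ge0// lee_fin mulr_ge0// exprn_ge0.
      apply: lee_sum => t _; rewrite exprS -mulrA EFinM -muleA lee_wpmul2l//.
      by apply: lower_integralZl => //; rewrite mulr_ge0// exprn_ge0.
    - by move=> t w; rewrite mule_ge0// lee_fin mulr_ge0// exprn_ge0.
  rewrite EFinM lee_wpmul2l//.
  apply: (@le_trans _ _ (\int[P]_w (g w + C)%:E)%E).
    apply: lower_le_integral => w.
      by apply: sume_ge0 => t _; rewrite mule_ge0// lee_fin mulr_ge0// exprn_ge0.
    by rewrite (le_trans (IHn _))// lee_fin lerD2r.
  have iC := integrable_cstP P C.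
  rewrite integral_EFinE ?RintegralD ?Rintegral_cstP//.
  exact: (integrableD measurableT ig iC).
rewrite (le_trans (leeD2l _ tail))//= -EFinM -EFinD lee_fin big_ord_recl /=.
rewrite [X in a * D * (_ + X)](eq_bigr (fun t : 'I_n => q * q ^+ t.+1)); last first.
  by move=> t _; rewrite /bump /= add1n exprS.
rewrite -mulr_sumr expr1.
(* Scaling the one-step inequality by [q] restores coefficient 1 on [delta x], since
   [q * (1 + a) = 1]. *)
have := ler_wpM2l q0 gle; rewrite !mulrDr mulrA [q * ((1 + a) * _)]mulrA.
have -> : q * (1 + a) = 1 by rewrite mulVf// gt_eqF// ltr_wpDr.
rewrite /C; lra.
Qed.

End Descent.

(** * Integrability and linearity of scalar, vector and matrix expectations *)

Section Integrals.
Context {R : realType} {d : measure_display} {Omega : measurableType d}.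
Variable P : probability Omega R.
Local Notation intg f := (P.-integrable setT (EFin \o f)).

Lemma intgD (f g : Omega -> R) : intg f -> intg g -> intg (fun w => f w + g w).
Proof. exact: integrableD. Qed.

Lemma intgB (f g : Omega -> R) : intg f -> intg g -> intg (fun w => f w - g w).
Proof. exact: integrableB. Qed.

Lemma intgZ (c : R) (f : Omega -> R) : intg f -> intg (fun w => c * f w).
Proof. exact: integrableZl. Qed.

Lemma intg_sum (I : Type) (s : seq I) (f : I -> Omega -> R) :
  (forall i, intg (f i)) -> intg (fun w => \sum_(i <- s) f i w).
Proof.
move=> fi; elim: s => [|i s IHs].
  by under eq_fun do rewrite big_nil; exact: integrable_cstP.
by under eq_fun do rewrite big_cons; exact: intgD.
Qed.

Lemma intg_measurable (f : Omega -> R) : intg f -> measurable_fun setT f.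
Proof. by move=> /integrableP[/measurable_EFinP]. Qed.

Lemma intg_ae_bounded (f g : Omega -> R) : measurable_fun setT f ->
  intg g -> {ae P, forall w, `|f w| <= g w} -> intg f.
Proof.
move=> mf ig fg; apply/integrableP; split; first exact/measurable_EFinP.
case/integrableP: (ig) => mg; apply: le_lt_trans; apply: ae_ge0_le_integral => //.
- by apply: measurableT_comp => //; exact/measurable_EFinP.
- by apply: measurableT_comp.
- apply: filterS fg => w fgw _; rewrite /= lee_fin (le_trans fgw)//; exact: ler_norm.
Qed.

Lemma intg_bounded (f g : Omega -> R) : measurable_fun setT f ->
  intg g -> (forall w, `|f w| <= g w) -> intg f.
Proof. by move=> mf ig fg; apply: (intg_ae_bounded mf ig); exact: aeW. Qed.

Lemma Rintegral_sum (I : Type) (s : seq I) (f : I -> Omega -> R) :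
  (forall i, intg (f i)) ->
  \int[P]_w \sum_(i <- s) f i w = \sum_(i <- s) \int[P]_w f i w.
Proof.
move=> fi; elim: s => [|i s IHs].
  by under [LHS]eq_Rintegral do rewrite big_nil; rewrite big_nil Rintegral_cstP.
under [LHS]eq_Rintegral do rewrite big_cons.
by rewrite RintegralD// ?IHs ?big_cons//; exact: intg_sum.
Qed.

(** The difference [g - f] agrees almost everywhere with its positive part, whose integral is
    nonnegative. *)
Lemma ae_le_Rintegral (f g : Omega -> R) : intg f -> intg g ->
  {ae P, forall w, f w <= g w} -> \int[P]_w f w <= \int[P]_w g w.
Proof.
move=> fi gi fg; rewrite -subr_ge0 -RintegralB//.
have hi := intgB gi fi; rewrite -lee_fin -integral_EFinE//.
rewrite (@ae_eq_integral _ _ _ P setT (fun w => (Num.max (g w - f w) 0)%:E))//.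
- by apply: integral_ge0 => w _; rewrite lee_fin le_max lexx orbT.
- exact: (measurable_int P).
- apply/measurable_EFinP; apply: measurable_maxr => //; exact: intg_measurable.
- by apply: filterS fg => w fgw _; rewrite max_l// subr_ge0.
Qed.

Section Matrices.
Context {n : nat}.

Lemma intg_dotv (u : 'cV[R]_n) (X : Omega -> 'cV[R]_n) :
  (forall i, intg (fun w => X w i ord0)) -> intg (fun w => dotv u (X w)).
Proof. by move=> iX; apply: intg_sum => i; exact: intgZ. Qed.

Lemma Rintegral_dotv (u : 'cV[R]_n) (X : Omega -> 'cV[R]_n) :
  (forall i, intg (fun w => X w i ord0)) ->
  \int[P]_w dotv u (X w) = dotv u (Emx P X).
Proof.
move=> iX; rewrite Rintegral_sum => [|i]; last exact: intgZ.
by apply: eq_bigr => i _; rewrite RintegralZl// mxE.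
Qed.

Lemma intg_mulmx (M : Omega -> 'M[R]_n) (v : 'cV[R]_n) i :
  (forall i j, intg (fun w => M w i j)) -> intg (fun w => (M w *m v) i ord0).
Proof.
move=> iM; under eq_fun do rewrite mxE.
by apply: intg_sum => j; under eq_fun do rewrite mulrC; exact: intgZ.
Qed.

Lemma Emx_mulmx (M : Omega -> 'M[R]_n) (v : 'cV[R]_n) :
  (forall i j, intg (fun w => M w i j)) -> Emx P (fun w => M w *m v) = Emx P M *m v.
Proof.
move=> iM; apply/matrixP => i k; rewrite !mxE.
under eq_Rintegral do rewrite mxE.
rewrite Rintegral_sum => [|j]; last by under eq_fun do rewrite mulrC; exact: intgZ.
apply: eq_bigr => j _; rewrite mxE mulrC -RintegralZl//.
by apply: eq_Rintegral => w _; rewrite mulrC.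
Qed.

End Matrices.
End Integrals.

(** * From a geometrically weighted sum to a minimum *)

Section WeightedMinimum.
Context {R : realType}.

Lemma exp1D_le3 (a : R) n : 0 <= a -> a * n%:R <= 1 -> (1 + a) ^+ n <= 3.
Proof.
move=> a0 an1.
(* With [z = a * k], the polynomial [1 + z + z ^+ 2] replaces the exponential on [[0, 1]] and equals
   3 at [z = 1]. The induction step has slack [a * z * (1 - z) + a ^+ 2]. *)
suff : forall k, (k <= n)%N -> (1 + a) ^+ k <= 1 + a * k%:R + (a * k%:R) ^+ 2.
  move=> /(_ n (leqnn n)) /le_trans; apply.
  have : 0 <= a * n%:R by rewrite mulr_ge0.
  by move: (a * n%:R) an1 => z z1 z0; nra.
elim=> [_|k IHk kn]; first by rewrite expr0 mulr0 addr0 expr0n addr0.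
rewrite exprSr -natr1 (mulrDr a) mulr1.
have x1 : a * k%:R <= 1.
  by rewrite (le_trans _ an1)// ler_wpM2l// ler_nat ltnW.
have x0 : 0 <= a * k%:R by rewrite mulr_ge0.
have := IHk (ltnW kn); move: x0 x1; set z := a * k%:R; set e := _ ^+ k => x0 x1 le.
rewrite (le_trans (ler_wpM2r _ le)) ?addr_ge0//.
have : 0 <= a * z * (1 - z) by rewrite mulr_ge0 ?subr_ge0// mulr_ge0.
by nra.
Qed.

(** The minimum times the total weight [W * gamma] is below the sum. Dividing, [W] cancels in the
    [D] term, while [W >= T / 3] yields the factor 3. *)
Lemma bigmin_le_of_weighted_sum (E : nat -> \bar R) T (gamma a D d0 : R) :
  (0 < T)%N -> 0 < gamma -> 0 <= a -> a * T%:R <= 1 -> 0 <= d0 ->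
  (forall t, 0 <= E t)%E ->
  (\sum_(t < T) ((1 + a)^-1 ^+ t.+1 * gamma)%:E * E t
     <= (d0 + a * D * \sum_(t < T) (1 + a)^-1 ^+ t.+1)%:E)%E ->
  (\big[Order.min/+oo]_(t < T) E t <= (3 * d0 / (gamma * T%:R) + a * D / gamma)%:E)%E.
Proof.
move=> T0 gamma0 a0 aT d00 E0 sumE; set q := (1 + a)^-1 in sumE *.
set m := \big[_/_]_(t < T) _.
have mle (t : 'I_T) : (m <= E t)%E by exact: bigmin_le_cond.
have m0 : (0 <= m)%E by apply/bigmin_geP; split => // [|t _]; exact: leey || exact: E0.
have q0 : 0 < q by rewrite invr_gt0 ltr_wpDr.
set W := \sum_(t < T) q ^+ t.+1 in sumE *.
have WT : T%:R / 3 <= W.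
  rewrite (_ : T%:R / 3 = \sum_(t < T) 3^-1); last first.
    by rewrite sumr_const card_ord mulr_natl.
  apply: ler_sum => t _; rewrite exprVn lef_pV2 ?posrE ?exprn_gt0 ?ltr_wpDr//.
  apply: le_trans (exp1D_le3 a0 aT); rewrite ler_weXn2l ?lerDl//.
have W0 : 0 < W by rewrite (lt_le_trans _ WT)// divr_gt0 ?ltr0n.
have {}sumE : ((W * gamma)%:E * m <= (d0 + a * D * W)%:E)%E.
  apply: le_trans sumE; rewrite mulr_suml -sumEFin ge0_sume_distrl => [|t _]; last first.
    by rewrite lee_fin mulr_ge0 ?ltW// exprn_gt0.
  by apply: lee_sum => t _; rewrite lee_wpmul2l// lee_fin mulr_ge0 ?ltW// exprn_gt0.
have Wg : 0 < W * gamma by rewrite mulr_gt0.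
move: sumE; rewrite -lee_pdivlMl// -EFinM => /le_trans; apply; rewrite lee_fin.
rewrite mulrDr lerD//; last first.
  by rewrite le_eqVlt; apply/orP; left; apply/eqP; field; rewrite !gt_eqF.
rewrite ler_pdivlMr ?mulr_gt0 ?ltr0n// -mulrA ler_pdivrMl//.
have : 0 <= (W - T%:R / 3) * (d0 * gamma).
  by apply: mulr_ge0; rewrite ?subr_ge0// mulr_ge0// ltW.
by move: (T%:R : R) => c; lra.
Qed.

End WeightedMinimum.

(** * Integrability, smoothness and differentiability of the sketched objective *)

Section SketchedObjective.
Context {R : realType} {n : nat} {d : measure_display} {Omega : measurableType d}.
Variables (P : probability Omega R) (S : Omega -> 'M[R]_n).
Variables (f : 'cV[R]_n -> R) (s : 'cV[R]_n) (L K m : R).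
Local Notation intg f := (P.-integrable setT (EFin \o f)).
Local Notation ft := (ftilde P S f s).
Local Notation ESS := (Emx P (fun w => (S w)^T *m S w)).

Hypothesis mS : forall i j, measurable_fun setT (fun w => S w i j).
Hypothesis iS : forall i j, intg (fun w => S w i j).
Hypothesis iSS : forall i j, intg (fun w => ((S w)^T *m S w) i j).
Hypothesis L_gt0 : 0 < L.
Hypothesis fL : Lsmooth L f.
Hypothesis K_ge0 : 0 <= K.
Hypothesis m_le : forall x, m <= f x.
Hypothesis S_le : {ae P, forall w, lambda_max ((S w)^T *m S w) <= K}.

Let y (x : 'cV[R]_n) w : 'cV[R]_n := s + S w *m (x - s).
(** By the chain rule, the gradient at [x] of the function [fS f s (S w)]. *)
Definition stoch_grad (x : 'cV[R]_n) w : 'cV[R]_n := (S w)^T *m grad f (y x w).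
Local Notation g := stoch_grad.

Let f_diff : forall x, differentiable f x := fL.1.

Let f_cont : continuous f.
Proof. by move=> x; exact: differentiable_continuous. Qed.

Let yD x h w : y (x + h) w = y x w + S w *m h.
Proof. by rewrite /y addrAC mulmxDr addrA. Qed.

Let dot_g x h w : dotv (g x w) h = dotv (grad f (y x w)) (S w *m h).
Proof. by rewrite dotv_mulmx. Qed.

Let my x i : measurable_fun setT (fun w => y x w i ord0).
Proof.
under eq_fun do rewrite !mxE; apply: measurable_funD => //.
by apply: measurable_sum => j; apply: measurable_funM.
Qed.

Let mfS x : measurable_fun setT (fun w => fS f s (S w) x).
Proof. exact: (measurable_continuous_comp f_cont (my x)). Qed.

Lemma intg_sqnorm_sketch h : intg (fun w => sqnorm (S w *m h)).
Proof.
under eq_fun do rewrite sqnorm_mulmx; apply: intg_dotv => i; exact: intg_mulmx.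
Qed.

Lemma Rintegral_sqnorm_sketch h : \int[P]_w sqnorm (S w *m h) = dotv h (ESS *m h).
Proof.
under eq_Rintegral do rewrite sqnorm_mulmx.
by rewrite Rintegral_dotv ?Emx_mulmx// => i; exact: intg_mulmx.
Qed.

Lemma tr_ESS : ESS^T = ESS.
Proof.
apply/matrixP => i j; rewrite !mxE; apply: eq_Rintegral => w _.
have SS_sym : ((S w)^T *m S w)^T = (S w)^T *m S w by rewrite trmx_mul trmxK.
by rewrite -[in RHS]SS_sym [RHS]mxE.
Qed.

Lemma Rintegral_sqnorm_sketch_le h :
  \int[P]_w sqnorm (S w *m h) <= lambda_max ESS * sqnorm h.
Proof.
by rewrite Rintegral_sqnorm_sketch; apply: dotv_le_lambda_max; exact: tr_ESS.
Qed.

Lemma lambda_max_ESS_ge0 : 0 <= lambda_max ESS.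
Proof.
apply: psd_lambda_max_ge0 => [|v]; first exact: tr_ESS.
by rewrite -Rintegral_sqnorm_sketch; apply: Rintegral_ge0 => w _; exact: sqnorm_ge0.
Qed.

(** The integrand lies between [m] and the quadratic upper bound of [f] at [s], integrable because
    [S] and [S^T *m S] are. *)
Lemma intg_fS x : intg (fun w => fS f s (S w) x).
Proof.
pose u w := f s + dotv (grad f s) (S w *m (x - s)) + L / 2 * sqnorm (S w *m (x - s)).
have iu : intg u.
  apply: intgD; last by apply: intgZ; exact: intg_sqnorm_sketch.
  apply: intgD; first exact: integrable_cstP.
  by apply: intg_dotv => i; exact: intg_mulmx.
have iu' := intgD (intgB iu (integrable_cstP P m)) (integrable_cstP P `|m|).
apply: (intg_bounded (mfS x) iu').
move=> w; have := m_le (y x w); have := fL.2 s (S w *m (x - s)).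
rewrite -/(u w) -/(fS f s (S w) x) => ub lb.
rewrite -[X in `|X|](subrK m) (le_trans (ler_normD _ _))// lerD2r.
by rewrite ger0_norm ?subr_ge0// lerD2r.
Qed.

Lemma le_ftilde x : m <= ft x.
Proof.
rewrite -[leLHS](Rintegral_cstP P); apply: le_Rintegral => //.
- exact: integrable_cstP.
- exact: intg_fS.
- by move=> w _; exact: m_le.
Qed.

Let mg x i : measurable_fun setT (fun w => g x w i ord0).
Proof.
under eq_fun do rewrite mxE; apply: measurable_sum => j.
under eq_fun do rewrite mxE; apply: measurable_funM => //.
exact: measurable_grad_comp.
Qed.

Let ae_sqnorm_g_le x :
  {ae P, forall w, sqnorm (g x w) <= 2 * L * K * (fS f s (S w) x - m)}.
Proof.
apply: filterS S_le => w Sw; rewrite (le_trans (sqnorm_trmx_mul_le _ Sw))//.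
rewrite [2 * L * K]mulrC -mulrA ler_wpM2l//; exact: Lsmooth_sqnorm_grad.
Qed.

Lemma intg_sqnorm_stoch_grad x : intg (fun w => sqnorm (g x w)).
Proof.
apply: (@intg_ae_bounded _ _ _ P _ (fun w => 2 * L * K * (fS f s (S w) x - m))).
- by apply: measurable_sum => i; apply: measurable_funM.
- by apply: intgZ; apply: intgB; [exact: intg_fS|exact: integrable_cstP].
- by apply: filterS (ae_sqnorm_g_le x) => w; rewrite ger0_norm ?sqnorm_ge0.
Qed.

Lemma Rintegral_sqnorm_stoch_grad_le x :
  \int[P]_w sqnorm (g x w) <= 2 * L * K * (ft x - m).
Proof.
have ifS := intg_fS x; have ifSm := intgB ifS (integrable_cstP P m).
apply: (le_trans (ae_le_Rintegral (intg_sqnorm_stoch_grad x) (intgZ (2 * L * K) ifSm)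
  (ae_sqnorm_g_le x))).
by rewrite RintegralZl// RintegralB// ?Rintegral_cstP//; exact: integrable_cstP.
Qed.

Lemma intg_stoch_grad x i : intg (fun w => g x w i ord0).
Proof.
apply: (intg_bounded (mg x i) (intgD (integrable_cstP P 1) (intg_sqnorm_stoch_grad x))).
(* A coordinate is at most 1 plus its square, so square integrability suffices. *)
move=> w; rewrite (le_trans _ (lerD (lexx 1) (coord_le_sqnorm _ i)))//.
by rewrite -[X in _ <= _ + X]real_normK ?num_real//; nra.
Qed.

(** Integrate the smoothness bound at [y x w] with increment [S w *m h]. Differentiability of [ft]
    is not presupposed, so the bound can identify its gradient. *)
Lemma ftilde_quadratic_upper_bound x h :
  ft (x + h) <= ft x + dotv (Emx P (g x)) h + L * lambda_max ESS / 2 * sqnorm h.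
Proof.
have ix := intg_fS x; have ih := intg_sqnorm_sketch h.
have ig : intg (fun w => dotv h (g x w)) by apply: intg_dotv; exact: intg_stoch_grad.
pose u w := fS f s (S w) x + dotv h (g x w) + L / 2 * sqnorm (S w *m h).
apply: (@le_trans _ _ (\int[P]_w u w)).
  apply: le_Rintegral => //; first exact: intg_fS.
    by apply: intgD; [exact: intgD|exact: intgZ].
  move=> w _; rewrite /u dotvC dot_g /fS -!/(y _ _) yD; exact: fL.2.
rewrite /u RintegralD//; [|exact: intgD|exact: intgZ].
rewrite RintegralD// RintegralZl// Rintegral_dotv; last exact: intg_stoch_grad.
rewrite dotvC lerD2l.
have := ler_wpM2l (ltW L_gt0) (Rintegral_sqnorm_sketch_le h); lra.
Qed.

Let rem x h w := fS f s (S w) (x + h) - fS f s (S w) x - dotv (g x w) h.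

Let intg_rem x h : intg (rem x h).
Proof.
apply: intgB; first by apply: intgB; exact: intg_fS.
under eq_fun do rewrite dotvC; apply: intg_dotv; exact: intg_stoch_grad.
Qed.

Let Rintegral_rem x h :
  \int[P]_w rem x h w = ft (x + h) - ft x - dotv (Emx P (g x)) h.
Proof.
have ig : intg (fun w => dotv (g x w) h).
  by under eq_fun do rewrite dotvC; apply: intg_dotv; exact: intg_stoch_grad.
have [i1 i2] := (intg_fS (x + h), intg_fS x).
rewrite RintegralB//; last exact: intgB.
rewrite RintegralB//; congr (_ - _).
under eq_Rintegral do rewrite dotvC.
rewrite Rintegral_dotv; [exact: dotvC|exact: intg_stoch_grad].
Qed.

(** An integrable majorant of the remainder divided by the norm of [h]. Its terms pay for the drop
    to [m], the linear part and the quadratic part at a unit vector; the factor [n] compares the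
    Euclidean norm with the sup norm. *)
Let dom x w := fS f s (S w) x - m + \sum_i `|g x w i ord0| + L / 2 * (K * n%:R).

Let intg_dom x : intg (dom x).
Proof.
apply: intgD; last exact: integrable_cstP.
apply: intgD; first by apply: intgB; [exact: intg_fS|exact: integrable_cstP].
by apply: intg_sum => i; exact: (integrable_norm (intg_stoch_grad x i)).
Qed.

(* Smoothness bounds f only from above; the lower bound on the remainder comes
   from semiconcavity along the segment to the unit vector in direction h,
   where f is bounded below by m. *)
Let ae_rem_le x : {ae P, forall w, forall h, `|h| <= 1 -> `|rem x h w| <= `|h| * dom x w}.
Proof.
apply: filterS S_le => w Sw h h1.
have sqle v : sqnorm (S w *m v) <= K * n%:R * `|v| ^+ 2.
  rewrite sqnorm_mulmx (le_trans (dotv_le_lambda_max _ _)) ?trmx_mul ?trmxK//.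
  rewrite (le_trans (ler_wpM2r (sqnorm_ge0 _) Sw))// -mulrA ler_wpM2l//.
  exact: sqnorm_le_norm.
have Kn0 : 0 <= K * n%:R by rewrite mulr_ge0.
have g0 : 0 <= \sum_i `|g x w i ord0| by apply: sumr_ge0.
have fm : 0 <= fS f s (S w) x - m by rewrite subr_ge0 m_le.
have ub : rem x h w <= `|h| * dom x w.
  have := fL.2 (y x w) (S w *m h); rewrite -dot_g -yD => ub.
  have ub2 : rem x h w <= L / 2 * sqnorm (S w *m h).
    by rewrite /rem /fS -!/(y _ _); lra.
  rewrite (le_trans ub2)//; have := sqle h => sqh.
  rewrite (le_trans (ler_wpM2l _ sqh)) ?divr_ge0 ?(ltW L_gt0)//.
  rewrite mulrA expr2 mulrA mulrC ler_wpM2l//.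
  have := mulr_ge0 (divr_ge0 (ltW L_gt0) (ler0n R 2)) Kn0 => LK.
  rewrite (le_trans (ler_piMr LK h1))// /dom; lra.
have [->|h0] := eqVneq h 0.
  rewrite normr0 mul0r /rem addr0 subrr sub0r dotvC /dotv big1 ?oppr0 ?normr0//.
  by move=> i _; rewrite mxE mul0r.
have nh0 : 0 < `|h| by rewrite normr_gt0.
pose u := `|h|^-1 *: h.
have hu : h = `|h| *: u by rewrite scalerA divff ?scale1r// normr_eq0.
have nu : `|u| = 1 by rewrite normrZ normfV normr_id mulVf// normr_eq0.
rewrite ler_norml ub andbT.
have t01 : 0 <= `|h| <= 1 by rewrite normr_ge0.
have := Lsmooth_semiconcave (y x w) (S w *m u) fL t01.
rewrite scalemxAr -hu -(yD x h) => sc.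
have gu : dotv (g x w) u <= \sum_i `|g x w i ord0|.
  apply: ler_sum => i _; rewrite (le_trans (ler_norm _))// normrM.
  by rewrite ler_piMr// -nu; exact: coord_le_norm.
have gh : dotv (g x w) h = `|h| * dotv (g x w) u by rewrite [in LHS]hu dotvZr.
have squ := sqle u; rewrite nu expr1n mulr1 in squ.
have fu := m_le (y x w + S w *m u).
rewrite /rem gh /dom /fS -!/(y _ _).
move: sc gu squ fu fm t01 (sqnorm_ge0 (S w *m u)); rewrite /fS -!/(y _ _).
move: (f (y x w)) (f (y (x + h) w)) (f (y x w + S w *m u)) => A B C.
move: (sqnorm _) (\sum_i _) (dotv _ _) `|h| (K * n%:R) => q G D t Q.
move=> sc gu squ fu fm /andP[t0 t1] q0.
(* After the semiconcavity bound, the slack is exactly the sum of the four products [p1] to [p4]. *)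
have p1 : 0 <= t * (C - m) by rewrite mulr_ge0// subr_ge0.
have p2 : 0 <= t * (G - D) by rewrite mulr_ge0// subr_ge0.
have L2 : 0 <= L / 2 by rewrite divr_ge0// ltW.
have p3 : 0 <= t * (L / 2 * (Q - q)).
  by apply: mulr_ge0 => //; apply: mulr_ge0 => //; rewrite subr_ge0.
have p4 : 0 <= t * (L / 2 * (t * q)).
  by apply: mulr_ge0 => //; apply: mulr_ge0 => //; exact: mulr_ge0.
lra.
Qed.

(** Dominated convergence concerns sequences, so a failure of differentiability is turned into
    vectors [h k] tending to 0 whose normalised remainders have integrals above [eps] in absolute
    value. *)
Lemma differentiable_ftilde x : differentiable ft x.
Proof.
apply: (@differentiable_of_remainder _ _ _ _ (Emx P (g x))) => eps e0.
apply: contrapT => not_near.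
have /choice[h hP] (k : nat) : exists h : 'cV[R]_n,
    `|h| < k.+1%:R^-1 /\ eps * `|h| < `|\int[P]_w rem x h w|.
  apply: contrapT => noh; apply: not_near; apply/nbhs_ballP.
  exists k.+1%:R^-1 => /=; first by rewrite invr_gt0.
  move=> h; rewrite -ball_normE /= sub0r normrN => hk.
  rewrite -Rintegral_rem leNgt; apply/negP => lt; apply: noh.
  by exists h.
have h_neq0 k : 0 < `|h k|.
  rewrite lt0r normr_ge0 andbT; apply/eqP => /eqP; rewrite normr_eq0 => /eqP hk0.
  have [_] := hP k; rewrite hk0 Rintegral_rem addr0 subrr sub0r normrN normr0 mulr0.
  by rewrite dotvC /dotv big1 ?normr0 ?ltxx// => i _; rewrite mxE mul0r.
pose phi k w := `|h k|^-1 * rem x (h k) w.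
have iphi k : intg (phi k) by exact: intgZ.
(* For a fixed draw this is differentiability of [f] at [y x w], composed with [S w]. *)
have phi0 w : (phi k w)%:E @[k --> \oo] --> (0%:E : \bar R).
  apply/fine_cvgP; split; first exact: nearW.
  apply/cvgrPdist_le => e e_gt0.
  have /nbhs_ballP[r /= r0 rP] :=
    differentiable_mulmx_remainder (S w) (f_diff (y x w)) e_gt0.
  have [N _ NP] := @cvg_harmonic R _ (nbhsx_ballx 0 _ r0).
  exists N => // k /NP; rewrite /= -ball_normE /= sub0r normrN gtr0_norm// => kr.
  rewrite sub0r normrN normrM normfV normr_id ler_pdivrMl// mulrC.
  have := rP (h k); rewrite -ball_normE /= sub0r normrN -dotv_grad -dot_g -yD; apply.
  by have [hk _] := hP k; rewrite (lt_trans hk).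
have phi_dom : {ae P, forall w k, setT w -> (`|(phi k w)%:E| <= (dom x w)%:E)%E}.
  apply: filterS (ae_rem_le x) => w wP k _; rewrite lee_fin normrM normfV normr_id.
  rewrite ler_pdivrMl//; apply: wP; have [hk _] := hP k.
  by rewrite (le_trans (ltW hk))// invf_le1 ?ler1n.
have [_ _ cvg0] := @dominated_convergence _ _ _ P setT measurableT
  (fun k w => (phi k w)%:E) (fun=> 0%:E) _ (fun k => measurable_int P (iphi k))
  (@measurable_cst _ _ _ _ _ _) (aeW P (fun w _ => phi0 w)) (intg_dom x) phi_dom.
have {cvg0} : \int[P]_w phi k w @[k --> \oo] --> (0 : R).
  by move: cvg0; rewrite integral0 => /fine_cvgP[].
move=> /cvgrPdist_lt/(_ _ e0)[k _ /(_ k (leqnn k))] /=.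
rewrite sub0r normrN RintegralZl//.
rewrite normrM normfV normr_id ltr_pdivrMl// mulrC => lt.
by have [_] := hP k; rewrite ltNge (ltW lt).
Qed.

Lemma grad_ftilde x : grad ft x = Emx P (g x).
Proof.
apply: grad_of_quadratic_upper_bound (differentiable_ftilde x) _ => h.
exact: ftilde_quadratic_upper_bound.
Qed.

(** Take for [u] the quadratic upper bound at the increment [- gamma *: g x w]. Its linear term
    averages to [- gamma * sqnorm G], its quadratic term to at most [a * (ft x - m)], which splits
    at [c]. *)
Lemma dsgd_onestep gamma c x (a := gamma ^+ 2 * L ^+ 2 * lambda_max ESS * K) :
  exists u : Omega -> R, [/\ intg u,
    forall w, ft (dsgd_step gamma f s (S w) x) - c <= u w &
    gamma * sqnorm (grad ft x) + \int[P]_w u w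
      <= (1 + a) * (ft x - c) + a * (c - m)].
Proof.
have LD0 := lambda_max_ESS_ge0; set G := Emx P (g x); set M := L * lambda_max ESS / 2.
have ig : intg (fun w => dotv G (g x w)) by apply: intg_dotv; exact: intg_stoch_grad.
have iq := intg_sqnorm_stoch_grad x; have ic := integrable_cstP P (ft x - c).
exists (fun w => ft x - c + (- gamma * dotv G (g x w) + M * gamma ^+ 2 * sqnorm (g x w))).
split; first by apply: intgD => //; apply: intgD; exact: intgZ.
  move=> w; have := ftilde_quadratic_upper_bound x (- gamma *: g x w).
  rewrite dotvZr sqnormZ sqrrN /dsgd_step scaleNr -/(y x w) -/(g x w) -/G -/M; lra.
rewrite RintegralD ?Rintegral_cstP//; last by apply: intgD; exact: intgZ.
rewrite RintegralD//; [|exact: intgZ|exact: intgZ].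
rewrite !RintegralZl// Rintegral_dotv; last exact: intg_stoch_grad.
rewrite -/G grad_ftilde -/G -/(sqnorm G).
have Mg : 0 <= M * gamma ^+ 2.
  by rewrite mulr_ge0 ?sqr_ge0// divr_ge0// mulr_ge0// ltW.
have := ler_wpM2l Mg (Rintegral_sqnorm_stoch_grad_le x).
by rewrite /M /a; lra.
Qed.

End SketchedObjective.

(** * Choice of constants and assembly of the convergence bound *)

Theorem theorem3 (R : realType) (dim : nat) (d0 : measure_display)
  (Omega : measurableType d0) (P : probability Omega R)
  (S : Omega -> 'M[R]_dim) (f : 'cV[R]_dim -> R) (s x0 : 'cV[R]_dim)
  (Lf LSmax gamma : R) (T : nat) :
  (* the random sketch S ~ D: measurable entries, E[S] = I, E[S^T S] finite *)
  (forall i j, measurable_fun setT (fun w => S w i j)) ->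
  (forall i j, P.-integrable setT (fun w => (S w i j)%:E)) ->
  Emx P S = 1%:M ->
  (forall i j, P.-integrable setT (fun w => (((S w)^T *m S w) i j)%:E)) ->
  (* f is L_f-smooth and bounded below *)
  Lsmooth Lf f ->
  (exists m : R, forall x, m <= f x) ->
  (* L_S^max is the smallest constant with lambda_max(S^T S) <= L_S^max a.s. *)
  {ae P, forall w, lambda_max ((S w)^T *m S w) <= LSmax} ->
  (forall c : R, {ae P, forall w, lambda_max ((S w)^T *m S w) <= c} -> LSmax <= c) ->
  (1 <= T)%N ->
  0 < gamma ->
  gamma <= 1 / (Lf * Num.sqrt (lambda_max (Emx P (fun w => (S w)^T *m S w)) * LSmax * T%:R)) ->
  let ft := ftilde P S f s in
  let LD := lambda_max (Emx P (fun w => (S w)^T *m S w)) in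
  (\big[Order.min/+oo%E]_(t < T)
      Eseq P t (fun l => (sqnorm (grad ft (dsgd gamma f s S x0 l)))%:E)
   <= (3 * (ft x0 - inf (range ft)) / (gamma * T%:R)
       + gamma * Lf ^+ 2 * LD * LSmax * (inf (range ft) - inf (range f)))%:E)%E.
Proof.
move=> mS iS _ iSS fL [m0 m0_le] S_le _ T1 gamma0 gamma_le; cbv zeta.
set ft := ftilde P S f s; set LD := lambda_max _ in gamma_le *.
have T0 : 0 < T%:R :> R by rewrite ltr0n.
(* Division by 0 returns 0, so a positive [gamma] under the step-size bound forces both factors of
   the denominator to be positive. *)
have /andP[Lf0 sqrt0] : (0 < Lf) && (0 < Num.sqrt (LD * LSmax * T%:R)).
  have := lt_le_trans gamma0 gamma_le; rewrite div1r invr_gt0 => LfK.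
  have sqrt0 : 0 < Num.sqrt (LD * LSmax * T%:R).
    by rewrite lt0r sqrtr_ge0 andbT; apply: contraTneq LfK => ->; rewrite mulr0 ltxx.
  by rewrite sqrt0 andbT -(pmulr_lgt0 _ sqrt0).
have LDK0 : 0 < LD * LSmax by move: sqrt0; rewrite sqrtr_gt0 pmulr_lgt0.
have LD0 : 0 <= LD by exact: lambda_max_ESS_ge0.
have K0 : 0 <= LSmax.
  rewrite leNgt; apply/negP => K_lt0; move: LDK0; rewrite ltNge => /negP; apply.
  by rewrite mulr_ge0_le0// ltW.
set finf := inf (range f); set ftinf := inf (range ft).
have finf_le x : finf <= f x.
  by apply: ge_inf; [exists m0 => _ [y _ <-]|exists x].
have finf_le_ft x : finf <= ft x by exact: (le_ftilde s mS iS iSS fL finf_le).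
have ftinf_le x : ftinf <= ft x.
  by apply: ge_inf; [exists finf => _ [y _ <-]|exists x].
have D0 : 0 <= ftinf - finf.
  by rewrite subr_ge0; apply: lb_le_inf; [exists (ft x0), x0|move=> _ [y _ <-]].
pose a := gamma ^+ 2 * Lf ^+ 2 * LD * LSmax.
have a0 : 0 <= a by rewrite /a -mulrA mulr_ge0 ?(ltW LDK0)// mulr_ge0 ?sqr_ge0.
(* This is the square of the step-size condition. *)
have aT : a * T%:R <= 1.
  have LfK0 : 0 < Lf * Num.sqrt (LD * LSmax * T%:R) by rewrite mulr_gt0.
  have := gamma_le; rewrite div1r -[X in _ <= X]mul1r ler_pdivlMr// => gL.
  have : (gamma * (Lf * Num.sqrt (LD * LSmax * T%:R))) ^+ 2 <= 1.
    by rewrite expr_le1// mulr_ge0 ?ltW.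
  rewrite !exprMn sqr_sqrtr; last by rewrite mulr_ge0 ?ltW.
  by rewrite /a; congr (_ <= _); ring.
have := @Eseq_descent R _ Omega P _ (fun x w => dsgd_step gamma f s (S w) x)
  (fun x => sqnorm (grad ft x)) (fun x => ft x - ftinf) gamma a (ftinf - finf)
  (ltW gamma0) a0 D0 (fun x => sqnorm_ge0 _).
move=> /(_ _ _ T x0) sumE.
have := @bigmin_le_of_weighted_sum R
  (fun t => Eseq P t (fun l => (sqnorm (grad ft (dsgd gamma f s S x0 l)))%:E))
  T gamma a (ftinf - finf) (ft x0 - ftinf) T1 gamma0 a0 aT.
move=> /(_ _ _ (sumE _ _)) => le.
apply: (le_trans (le _ _ _ _)).
- by rewrite subr_ge0.
- by move=> t; apply: Eseq_ge0 => l; rewrite lee_fin sqnorm_ge0.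
- by move=> x; rewrite subr_ge0.
(* The offset [c] is the infimum of [ft], and [m] is the infimum of [f]. *)
- by move=> x; exact (dsgd_onestep s mS iS iSS Lf0 fL K0 finf_le S_le gamma ftinf x).
rewrite lee_fin lerD2l le_eqVlt; apply/orP; left; apply/eqP.
by rewrite /a; field; exact: lt0r_neq0.
Qed.
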